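(* Let $T$ be a fixed graph and let $\mathcal{F}$ be a family of graphs such that there is a graph $F\in\mathcal{F}$ which is a subgraph of a blow-up of $T$. Then there is a fixed $\epsilon=\epsilon(T,\mathcal{F})>0$ such that, for an input graph $G$ on $n$ vertices, $\mathrm{ex}(G,T,\mathcal{F})$ can be calculated in polynomial time up to an additive error of $n^{v(T)-\epsilon}$.
   Context: Graphs are finite and simple; $v(T)$ denotes the number of vertices of $T$. A copy of $T$ in a graph $H$ is a (not necessarily induced) subgraph of $H$ isomorphic to $T$. A graph is $\mathcal{F}$-free if it contains no copy of any $F\in\mathcal{F}$. For graphs $G,T$ and a family of graphs $\mathcal{F}$, $\mathrm{ex}(G,T,\mathcal{F})$ denotes the maximum number of copies of $T$ in an $\mathcal{F}$-free subgraph of $G$. For an integer $m\ge 1$, the $m$ blow-up of $T$ is the graph obtained by replacing each vertex of $T$ by an independent set of size $m$ and each edge by a complete bipartite graph between the corresponding independent sets; a blow-up of $T$ is an $m$ blow-up for some $m$. The parameters $T,\mathcal{F}$ are fixed, the input is $G$, and ''polynomial time'' means polynomial in $n$. ''Calculated up to an additive error of $a$'' means that the algorithm outputs a number $x$ with $|x-\mathrm{ex}(G,T,\mathcal{F})|\le a$. *)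

(* Defs.v *)
From HB Require Import structures.
From mathcomp Require Import all_boot all_order all_algebra.
From mathcomp Require Import boolp.

Set Implicit Arguments.
Unset Strict Implicit.
Unset Printing Implicit Defensive.

Import Order.TTheory GRing.Theory Num.Theory.

Record sgraph := SGraph {
  vertex :> finType;
  edges : {set {set vertex}};
  edges_card2 : [forall e in edges, #|e| == 2]
}.

(* A vertex set together with a set of unordered pairs; these are the
   candidates for subgraphs of a graph on V, well-formedness being part of
   [subgraph]. *)
Definition pregraph (V : finType) := ({set V} * {set {set V}})%type.

Definition full (G : sgraph) : pregraph G := ([set: G], edges G).

Definition subgraph (V : finType) (K H : pregraph V) : bool :=
  [&& K.1 \subset H.1, K.2 \subset H.2 & [forall e in K.2, e \subset K.1]].

Definition isomorphic (T : sgraph) (V : finType) (K : pregraph V) : bool :=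
  [exists f : {ffun T -> V},
    [&& injectiveb f, f @: [set: T] == K.1
      & [set f @: e | e : {set T} in edges T] == K.2]].

Definition copies (T : sgraph) (V : finType) (H : pregraph V) :
    {set pregraph V} :=
  [set K | subgraph K H & isomorphic T K].

Definition contains (V : finType) (H : pregraph V) (T : sgraph) : bool :=
  0 < #|copies T H|.

Definition family_free (F : sgraph -> Prop) (V : finType) (H : pregraph V) : Prop :=
  forall A, F A -> ~ contains H A.

(* A subgraph need not be spanning. The maximum over an empty range is 0;
   this only happens when F contains the graph without vertices. *)
Definition gen_turan (G T : sgraph) (F : sgraph -> Prop) : nat :=
  \max_(H : pregraph G | subgraph H (full G) && `[< family_free F H >])
     #|copies T H|.

Definition blowup_edges (T : sgraph) (m : nat) : {set {set T * 'I_m}} :=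
  [set [set u; v] | u in [set: T * 'I_m],
                    v in [set v | [set u.1; v.1] \in edges T]].

Fact blowup_card2 (T : sgraph) (m : nat) :
  [forall e in blowup_edges T m, #|e| == 2].
Proof.
apply/forall_inP => _ /imset2P[u v _ + ->]; rewrite inE => uvT.
have [uv|] := eqVneq u v; last by rewrite cards2 => ->.
move: uvT; rewrite uv setUid => /(forall_inP (edges_card2 T)).
by rewrite cards1.
Qed.

Definition blowup (T : sgraph) (m : nat) : sgraph :=
  SGraph (blowup_card2 T m).

(* Deterministic one-tape Turing machines with a two-way infinite tape. A cell
   holds None (blank) or a symbol, which is either an input/output symbol or
   one from an arbitrary finite auxiliary alphabet. *)
Inductive iosymbol := Bit of bool | Minus | Slash.

Inductive move := MoveLeft | Stay | MoveRight.

Record machine := Machine {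
  state : finType;
  aux : finType;
  start : state;
  halting : pred state;
  trans : state -> option (iosymbol + aux) ->
          state * option (iosymbol + aux) * move
}.

Definition cell (M : machine) := option (iosymbol + aux M).

Record config (M : machine) := Config {
  cstate : state M;
  chead : int;
  ctape : int -> cell M
}.

Definition move_head (d : move) (z : int) : int :=
  match d with MoveLeft => z - 1 | Stay => z | MoveRight => z + 1 end%R.

Definition step (M : machine) (c : config M) : config M :=
  if halting (cstate c) then c else
  let: (q, s, d) := trans (cstate c) (ctape c (chead c)) in
  Config q (move_head d (chead c))
    (fun z => if z == chead c then s else ctape c z).

Definition wordcell (M : machine) (w : seq iosymbol) (k : nat) : cell M :=
  omap inl (onth w k).

Definition init (M : machine) (w : seq iosymbol) : config M :=
  Config (start M) 0%R
    (fun z => if z is Posz k then wordcell M w k else None).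

(* The output is the word between the head and the first blank to its right:
   at k = size w the cell is required to be blank. *)
Definition output (M : machine) (c : config M) (w : seq iosymbol) : Prop :=
  forall k : nat, k <= size w -> ctape c (chead c + k%:Z)%R = wordcell M w k.

Definition computes_in (M : machine) (w : seq iosymbol) (t : nat)
    (w' : seq iosymbol) : Prop :=
  let c := iter t (@step M) (init M w) in
  halting (cstate c) /\ output c w'.

(* Row-major adjacency matrix. Since the carrier is an arbitrary finType,
   every ordering of the vertices arises as an enumeration. *)
Definition encode_graph (G : sgraph) : seq iosymbol :=
  [seq Bit ([set x; y] \in edges G) | x <- enum G, y <- enum G].

Definition encode_nat (n : nat) : seq iosymbol :=
  [seq Bit (odd (n %/ 2 ^ i)) | i <- rev (iota 0 (trunc_log 2 n).+1)].

Definition encode_rat (x : rat) : seq iosymbol :=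
  (if (x < 0)%R then [:: Minus] else [::]) ++
  encode_nat `|numq x|%N ++ Slash :: encode_nat `|denq x|%N.

Definition polynomial_time (f : sgraph -> rat) : Prop :=
  exists (M : machine) (p : {poly nat}), forall G : sgraph,
    exists2 t : nat, t <= p.[#|G|]%R
      & computes_in M (encode_graph G) t (encode_rat (f G)).

(* Main.v *)
Require Import Defs.
From mathcomp Require Import all_boot all_order all_algebra.
From mathcomp Require Import all_classical all_reals all_analysis.
From mathcomp Require Import zify.

(** The number ex(G, T, F) is so small that a near-constant estimate suffices.

    Let k = #|T|, let n be the number of vertices of G, and let A be a member
    of the family contained in the blow-up of T with parts of size m.  Consider
    the set E of k-tuples of vertices of H, an F-free subgraph of G, that embed
    T in H.  If sets Y_1, ..., Y_k of m vertices each have their product inside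
    E, they span a blow-up of T in H, hence a copy of A; so E contains no such
    box.  By the theorem of Erdos on k-partite k-uniform hypergraphs, proved
    here by counting ([box_free_bound]), |E| = O(n^(k - m^-k)): iterating the
    power mean inequality over the k coordinates yields at least
    n^(km) (|E| / n^k)^(m^k) boxes with repetitions allowed ([boxes_lower]),
    while only O(n^(km - 1)) boxes have a repeated vertex in some part
    ([sum_degenerate_box]).  So ex(G, T, F) = O(n^(k - m^-k)).

    The constant hidden in this bound is removed without a table of the small
    graphs.  For k >= 2 the trivial bound ex(G, T, F) <= n^k - 1 already gives
    ex(G, T, F) <= n^(k - eps) for all n below a fixed threshold, provided that
    eps is small enough ([exponent_gap]); hence 0 is a good estimate for every
    G.  For k = 0 the value is 0.  For k = 1 the trivial bound is n, which may
    be attained for small n, and the estimate 1 repairs this unless G is empty,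
    where the error must be exactly 0.  The resulting estimate depends only on
    whether G has a vertex, so a machine computes it by looking at one cell
    ([polynomial_time_nonempty_indicator]). *)

Import Order.TTheory GRing.Theory Num.Theory.

Set Implicit Arguments.
Unset Strict Implicit.
Unset Printing Implicit Defensive.

(** * Finite sums and powers *)

Lemma ffact_le_expn (n m : nat) : n ^_ m <= n ^ m.
Proof.
by elim: m => // m IHm; rewrite ffactnSr expnSr leq_mul ?leq_subr.
Qed.

Lemma ltn_ffact_expn (n k : nat) : 0 < n -> n ^_ k.+2 < n ^ k.+2.
Proof.
case: n => // n _; rewrite ffactSS expnS ltn_pmul2l //.
by rewrite (leq_ltn_trans (ffact_le_expn _ _)) // ltn_exp2r.
Qed.

(** By induction on the exponent from Chebyshev's sum inequality, which is the
    sum over all pairs of a b^m + b a^m <= a^(m+1) + b^(m+1). *)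
Lemma power_mean (X : finType) (a : X -> nat) (m : nat) :
  #|X| * (\sum_x a x) ^ m <= #|X| ^ m * \sum_x a x ^ m.
Proof.
elim: m => [|m IHm]; first by rewrite !muln1 mul1n sum1_card.
suff chebyshev : (\sum_x a x) * (\sum_x a x ^ m) <= #|X| * \sum_x a x ^ m.+1.
  have := leq_mul (leqnn (\sum_x a x)) IHm.
  have := leq_mul (leqnn (#|X| ^ m)) chebyshev.
  by rewrite !expnS; nia.
suff : \sum_x \sum_y (a x * a y ^ m + a y * a x ^ m) <=
       \sum_x \sum_y (a x ^ m.+1 + a y ^ m.+1).
  have expand (b c : X -> nat) :
    \sum_x \sum_y b x * c y = (\sum_x b x) * (\sum_x c x).
    by rewrite big_distrlr.
  have splits (b c : X -> X -> nat) : \sum_x \sum_y (b x y + c x y) =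
      \sum_x \sum_y b x y + \sum_y \sum_x c x y.
    rewrite [X in _ + X]exchange_big -big_split.
    by apply: eq_bigr => x _; rewrite -big_split.
  have const : \sum_x \sum_(y : X) a x ^ m.+1 = #|X| * \sum_x a x ^ m.+1.
    by rewrite big_distrr; apply: eq_bigr => x _; rewrite sum_nat_const.
  by rewrite !splits !expand !const; lia.
rewrite leq_sum // => x _; rewrite leq_sum // => y _.
rewrite !expnS; move: (a x) (a y) => b c.
wlog le_bc : b c / b <= c => [th|].
  by case/orP: (leq_total b c) => /th //; lia.
have : b ^ m <= c ^ m by case: (posnP m) => [-> //|m0]; rewrite leq_exp2r.
nia.
Qed.

Lemma sum_bool_card (X : finType) (P : pred X) : \sum_x P x = #|P|.
Proof.
rewrite -sum1_card [RHS]big_mkcond; apply: eq_bigr => x _.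
by rewrite unfold_in; case: (P x).
Qed.

Lemma sum_tupleS (V : finType) (k : nat) (F : k.+1.-tuple V -> nat) :
  \sum_t F t = \sum_v \sum_(s : k.-tuple V) F [tuple of v :: s].
Proof.
rewrite pair_big /=.
rewrite (reindex (fun p : V * k.-tuple V => [tuple of p.1 :: p.2])) //=.
exists (fun t => (thead t, [tuple of behead t])) => [[v s] _|t _] /=.
  by congr (_, _); apply: val_inj.
by rewrite -tuple_eta.
Qed.

Lemma sum_tuple0 (V : finType) (F : 0.-tuple V -> nat) : \sum_t F t = F [tuple].
Proof. by apply: big_pred1 => t /=; apply/esym/eqP; apply: tuple0. Qed.

Lemma expn_sum_tuple (V : finType) (m : nat) (F : V -> nat) :
  (\sum_v F v) ^ m = \sum_(y : m.-tuple V) \prod_(v <- y) F v.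
Proof.
elim: m => [|m IHm].
  by rewrite sum_tuple0 big_nil.
rewrite expnS IHm sum_tupleS big_distrl; apply: eq_bigr => v _ /=.
by rewrite big_distrr; apply: eq_bigr => y _; rewrite big_cons.
Qed.

(** * Boxes in a set of tuples *)

Section Boxes.
Variables (V : finType) (m : nat).

(** The m-tuples in Y are the sides of a box; entries may be repeated, so that
    the boxes can be counted one coordinate at a time. *)
Definition in_box (k : nat) (Y : k.-tuple (m.-tuple V))
    (E : pred (k.-tuple V)) :=
  [forall t : k.-tuple V, [forall i, tnth t i \in tnth Y i] ==> E t].

Definition proper_box (k : nat) (Y : k.-tuple (m.-tuple V)) :=
  all (fun y : m.-tuple V => uniq y) Y.

(** The tuples s that extend to E by every entry of y: the boxes in E with first
    side y are the boxes in this set ([in_box_cons]). *)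
Definition slice (k : nat) (y : m.-tuple V) (E : pred (k.+1.-tuple V)) :
    pred (k.-tuple V) :=
  fun s => all (fun v => E [tuple of v :: s]) y.

Lemma in_box_cons (k : nat) (y : m.-tuple V) (Y : k.-tuple (m.-tuple V))
    (E : pred (k.+1.-tuple V)) :
  in_box [tuple of y :: Y] E = in_box Y (slice y E).
Proof.
apply/forallP/forallP => boxE t; apply/implyP=> /forallP tY.
  apply/allP => v vy; apply: (implyP (boxE _)); apply/forallP => i.
  by case: (unliftP ord0 i) => [j|] ->; rewrite ?tnthS ?tnth0.
case/tupleP: t tY => v s tY.
have /implyP := boxE s; rewrite /slice => sE.
have {}sE : all (fun v => E [tuple of v :: s]) y.
  by apply: sE; apply/forallP => i; have := tY (lift ord0 i); rewrite !tnthS.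
by apply: (allP sE); have := tY ord0; rewrite !tnth0.
Qed.

(** Double counting of the pairs (s, y) where every entry of y extends s. *)
Lemma sum_expn_slice (k : nat) (E : pred (k.+1.-tuple V)) :
  \sum_(s : k.-tuple V) (\sum_v E [tuple of v :: s]) ^ m =
  \sum_(y : m.-tuple V) \sum_s slice y E s.
Proof.
rewrite [RHS]exchange_big /=; apply: eq_bigr => s _; rewrite expn_sum_tuple.
apply: eq_bigr => y _; rewrite /slice; elim: (tval y) => [|v vs IHvs].
  by rewrite big_nil.
by rewrite big_cons IHvs mulnb.
Qed.

(** In terms of densities: if E has density d among all k-tuples, then boxes
    have density at least d^(m^k).  The power mean inequality is used twice in
    each step: over the tails s, to see that an average slice has density at
    least d^m, and over the first sides y, to average the bounds that the
    induction hypothesis gives for the slices. *)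
Lemma boxes_lower (k : nat) (E : pred (k.-tuple V)) : 0 < m -> 0 < #|V| ->
  (\sum_t E t) ^ (m ^ k) * #|V| ^ (k * m) <=
  (\sum_(Y : k.-tuple (m.-tuple V)) in_box Y E) * #|V| ^ (k * m ^ k).
Proof.
move=> m_gt0 V_gt0; elim: k E => [|k IHk] E.
  rewrite !expn1 !muln1 leq_eqVlt; apply/orP; left; apply/eqP.
  rewrite !sum_tuple0; congr nat_of_bool.
  apply/idP/forallP => [Et t|/(_ [tuple])].
    by rewrite [t]tuple0 Et implybT.
  by move/implyP; apply; apply/forallP => -[].
set M := m ^ k; set n := #|V|.
set e := fun y : m.-tuple V => \sum_s slice y E s.
(* Mean over the tails s, whose degrees into the first coordinate sum to |E|. *)
have mean1 : (\sum_t E t) ^ m * n ^ k <= n ^ (k * m) * \sum_y e y.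
  rewrite -sum_expn_slice sum_tupleS exchange_big /= mulnC.
  by have := power_mean (fun s : k.-tuple V => \sum_v E [tuple of v :: s]) m;
     rewrite card_tuple expnM.
(* Mean over the first sides y. *)
have mean2 : n ^ m * (\sum_y e y) ^ M <= n ^ (m * M) * \sum_y e y ^ M.
  by have := power_mean e M; rewrite card_tuple -expnM.
have slices : (\sum_y e y ^ M) * n ^ (k * m) <=
    (\sum_(Y : k.+1.-tuple (m.-tuple V)) in_box Y E) * n ^ (k * M).
  rewrite sum_tupleS !big_distrl leq_sum // => y _.
  under [X in _ <= X * _]eq_bigr do rewrite in_box_cons.
  exact: IHk.
rewrite -(leq_pmul2r (_ : 0 < n ^ (k * M))) ?expn_gt0 ?V_gt0 //.
have mean1M : (\sum_t E t) ^ (m ^ k.+1) * n ^ (k * M) <=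
    n ^ (k * m * M) * (\sum_y e y) ^ M.
  by rewrite expnS !expnM -!expnMn -/M leq_exp2r ?expn_gt0 ?m_gt0 // -expnM.
have := leq_mul mean1M (leqnn (n ^ m * n ^ (k * m))).
have := leq_mul mean2 (leqnn (n ^ (k * m * M) * n ^ (k * m))).
have := leq_mul slices (leqnn (n ^ (k * m * M) * n ^ (m * M))).
have -> : m ^ k.+1 = m * M by rewrite expnS.
have -> : k.+1 * (m * M) = m * M + k * m * M by lia.
by rewrite mulSn !expnD; lia.
Qed.

(** All but a fraction m^2 / n of the m-tuples have distinct entries, because an
    entry repeats one of its r predecessors in at most a fraction r / n. *)
Lemma leq_ffact_gap (n : nat) : n * n ^ m <= n * n ^_ m + m ^ 2 * n ^ m.
Proof.
elim: m => [|r IHr]; first by rewrite ffactn0 leq_addr.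
have le_F : n ^_ r * (n * r) <= n ^ r * (n * r).
  by rewrite leq_mul // ffact_le_expn.
have split_F : n * (n ^_ r * n) <= n * (n ^_ r * (n - r)) + n * (n ^_ r * r).
  by rewrite -mulnDr -mulnDr leq_mul // leq_mul //; lia.
have := leq_mul IHr (leqnn n).
by rewrite ffactnSr (expnSr n) -!mulnn; lia.
Qed.

(** If u falls short of N by a fraction at most c / n, then u^k falls short of
    N^k by a fraction at most k c / n. *)
Lemma leq_expn_gap (k n u N c : nat) : u <= N -> n * N <= n * u + c * N ->
  n * N ^ k <= n * u ^ k + k * c * N ^ k.
Proof.
move=> le_uN gap; elim: k => [|k IHk]; first by rewrite !expn0; lia.
have le_k : u ^ k <= N ^ k by case: (posnP k) => [-> //|k0]; rewrite leq_exp2r.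
have := leq_mul IHk (leqnn N); have := leq_mul gap (leqnn (u ^ k)).
by have := leq_mul le_k (leqnn (c * N)); rewrite !expnS; nia.
Qed.

Lemma sum_uniq_tuple : \sum_(y : m.-tuple V) uniq y = #|V| ^_ m.
Proof.
rewrite -(card_uniq_tuples m V) -sum1_card [RHS]big_mkcond.
apply: eq_bigr => y _; rewrite inE (_ : all _ y = true); last exact/allP.
by case: (uniq y).
Qed.

(** Boxes with a repeated entry are a fraction k m^2 / n of all boxes. *)
Lemma sum_degenerate_box (k : nat) :
  #|V| * \sum_(Y : k.-tuple (m.-tuple V)) ~~ proper_box Y <=
  k * m ^ 2 * #|V| ^ (k * m).
Proof.
have uniq_all : \sum_(Y : k.-tuple (m.-tuple V)) proper_box Y = (#|V| ^_ m) ^ k.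
  rewrite -sum_uniq_tuple expn_sum_tuple; apply: eq_bigr => Y _.
  rewrite /proper_box; elim: (tval Y) => [|y ys IHys]; first by rewrite big_nil.
  by rewrite big_cons -IHys -mulnb.
have total : \sum_(Y : k.-tuple (m.-tuple V)) ~~ proper_box Y +
    (#|V| ^_ m) ^ k = (#|V| ^ m) ^ k.
  rewrite -uniq_all -big_split /= -!card_tuple -sum1_card.
  by apply: eq_bigr => Y _; case: (proper_box _).
have le_N : #|V| ^_ m <= #|V| ^ m by exact: ffact_le_expn.
have := leq_expn_gap k le_N (leq_ffact_gap #|V|).
by rewrite -total (mulnC k m) expnM -total; lia.
Qed.

(** The theorem of Erdos: when every box in E is degenerate, the lower bound on
    the number of boxes is at most the number of degenerate ones. *)
Lemma box_free_bound (k : nat) (E : pred (k.-tuple V)) :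
    0 < m -> 0 < #|V| ->
    (forall Y : k.-tuple (m.-tuple V), proper_box Y -> ~~ in_box Y E) ->
  (\sum_t E t) ^ (m ^ k) * #|V| <= k * m ^ 2 * #|V| ^ (k * m ^ k).
Proof.
move=> m_gt0 V_gt0 noboxE.
have le_deg : \sum_(Y : k.-tuple (m.-tuple V)) in_box Y E <=
              \sum_(Y : k.-tuple (m.-tuple V)) ~~ proper_box Y.
  apply: leq_sum => Y _; have [/noboxE/negPf ->//|_] := boolP (proper_box Y).
  by case: (in_box _ _).
rewrite -(leq_pmul2r (_ : 0 < #|V| ^ (k * m))) ?expn_gt0 ?V_gt0 //.
rewrite mulnAC (leq_trans (leq_mul (boxes_lower E m_gt0 V_gt0) (leqnn _))) //.
rewrite mulnAC [X in _ <= X]mulnAC leq_mul //.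
rewrite (leq_trans _ (sum_degenerate_box k)) //.
by rewrite mulnC leq_mul.
Qed.

End Boxes.

(** * Copies of T and embeddings *)

Section Embeddings.
Variables (T : sgraph) (V : finType).
Implicit Types (H : pregraph V) (t : #|T|.-tuple V).

Definition vertex_map t (x : T) : V := tnth t (enum_rank x).

Definition image_pregraph t : pregraph V :=
  (vertex_map t @: [set: T], [set vertex_map t @: e | e : {set T} in edges T]).

Definition embedding H : pred (#|T|.-tuple V) :=
  [pred t : #|T|.-tuple V | uniq t & subgraph (image_pregraph t) H].

Lemma vertex_map_inj t : uniq t -> injective (vertex_map t).
Proof. by move=> /tuple_uniqP t_inj x y /t_inj /enum_rank_inj. Qed.

(** An embedding determines the copy that is its image. *)
Lemma leq_copies_embedding H : #|copies T H| <= \sum_t embedding H t.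
Proof.
rewrite sum_bool_card.
apply: leq_trans (leq_imset_card image_pregraph (embedding H)).
apply: subset_leq_card; apply/fintype.subsetP => K; rewrite inE => /andP[KH].
case/existsP=> f /and3P[/injectiveP f_inj /eqP K1 /eqP K2].
pose t := [tuple f (enum_val i) | i < #|T|].
have tf : vertex_map t =1 f.
  by move=> x; rewrite /vertex_map tnth_map tnth_ord_tuple enum_rankK.
have KE : image_pregraph t = K.
  rewrite [K]surjective_pairing -K1 -K2 /image_pregraph (eq_imset _ tf).
  by congr (_, _); apply: eq_imset => e; apply: eq_imset.
apply/imsetP; exists t; rewrite ?KE // !inE KE KH andbT.
apply/tuple_uniqP => i j; rewrite !tnth_map !tnth_ord_tuple.
by move=> /f_inj /enum_val_inj.
Qed.

Lemma embedding_leq_ffact H : \sum_t embedding H t <= #|V| ^_ #|T|.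
Proof.
rewrite -sum_uniq_tuple; apply: leq_sum => t _.
have : embedding H t -> uniq t by case/andP.
by case: (embedding H t) => // ->.
Qed.

Lemma contains_of_map (A : sgraph) (H : pregraph V) (f : A -> V) :
  injective f -> (forall x, f x \in H.1) ->
  (forall e, e \in edges A -> f @: e \in H.2) -> contains H A.
Proof.
move=> f_inj fV fE; apply/card_gt0P.
exists (f @: [set: A], [set f @: e | e : {set A} in edges A]).
rewrite inE; apply/andP; split.
  apply/and3P; split; first by apply/fintype.subsetP => _ /imsetP[x _ ->].
    by apply/fintype.subsetP => _ /imsetP[e eA ->]; exact: fE.
  by apply/forall_inP => _ /imsetP[e eA ->]; rewrite imsetS ?subsetT.
apply/existsP; exists (finfun f); rewrite (eq_imset _ (ffunE f)) eqxx /=.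
apply/andP; split; first by apply/injectiveP => x y; rewrite !ffunE => /f_inj.
by apply/eqP; apply: eq_imset => e; apply: eq_imset => x; rewrite ffunE.
Qed.

Lemma contains_of_blowup_map (A : sgraph) (m : nat) (H : pregraph V)
    (g : blowup T m -> V) :
  injective g -> (forall u, g u \in H.1) ->
  (forall u v, [set u.1; v.1] \in edges T -> [set g u; g v] \in H.2) ->
  contains (full (blowup T m)) A -> contains H A.
Proof.
move=> g_inj gV gE /card_gt0P[K]; rewrite inE => /andP[/and3P[_ KE _]].
case/existsP=> f /and3P[/injectiveP f_inj _ /eqP K2].
apply: (@contains_of_map A H (g \o f)) => [|x|e eA]; first exact: inj_comp.
  exact: gV.
rewrite imset_comp; have : f @: e \in edges (blowup T m).
  by apply: (fintype.subsetP KE); rewrite -K2; apply: imset_f.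
by case/imset2P => u v _; rewrite inE => uv ->; rewrite imsetU !imset_set1 gE.
Qed.

(** The sides of a box of embeddings span a blow-up of T.  They are disjoint
    because embeddings are injective, and two vertices on sides that belong to
    adjacent vertices of T are adjacent because some tuple of the box passes
    through both. *)
Lemma contains_of_box (A : sgraph) (m : nat) (H : pregraph V)
    (Y : #|T|.-tuple (m.-tuple V)) :
  proper_box Y -> in_box Y (embedding H) ->
  contains (full (blowup T m)) A -> contains H A.
Proof.
move=> /all_tnthP Y_uniq /forallP boxY.
pose g (u : blowup T m) := tnth (tnth Y (enum_rank u.1)) u.2.
(* A tuple of the box through both g u and g v; u.2 serves as an arbitrary index
   on the other sides. *)
pose t u v := [tuple if i == enum_rank u.1 then g u else
                     if i == enum_rank v.1 then g v
                     else tnth (tnth Y i) u.2 | i < #|T|].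
have tE u v : embedding H (t u v).
  apply: (implyP (boxY _)); apply/forallP => i; rewrite tnth_map tnth_ord_tuple.
  by case: eqP => [->|_]; [|case: eqP => [->|_]]; exact: mem_tnth.
have tu u v : vertex_map (t u v) u.1 = g u.
  by rewrite /vertex_map tnth_map tnth_ord_tuple eqxx.
have tv u v : u.1 != v.1 -> vertex_map (t u v) v.1 = g v.
  move=> uv; rewrite /vertex_map tnth_map tnth_ord_tuple eqxx.
  by rewrite (inj_eq enum_rank_inj) eq_sym (negPf uv).
apply: (@contains_of_blowup_map A m H g) => [u v|u|u v uvT].
- have [uv|uv] := eqVneq u.1 v.1.
    move: u v uv => [x i] [_ j] /= <-; rewrite /g /= => gij.
    by have /tuple_uniqP/(_ _ _ gij) -> := Y_uniq (enum_rank x).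
  rewrite -(tu u v) -(tv u v) // => tuv; move: uv.
  by have /andP[/vertex_map_inj/(_ _ _ tuv) -> _] := tE u v; rewrite eqxx.
- rewrite -(tu u u); have /andP[_ /and3P[/fintype.subsetP tH _ _]] := tE u u.
  by apply: tH; apply: imset_f.
have uv : u.1 != v.1.
  by move/(forall_inP (edges_card2 T)): uvT; rewrite cards2; case: (_ != _).
have /andP[_ /and3P[_ /fintype.subsetP tH _]] := tE u v.
apply: tH; apply/imsetP; exists [set u.1; v.1] => //.
by rewrite imsetU1 imset_set1 tu tv.
Qed.
End Embeddings.

(** * Bounds on the generalized Turan number *)

Section GenTuran.
Variables (T A : sgraph) (F : sgraph -> Prop) (m : nat).
Hypotheses (FA : F A) (m_gt0 : 0 < m) (mA : contains (full (blowup T m)) A).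

Lemma free_box (V : finType) (H : pregraph V) (Y : #|T|.-tuple (m.-tuple V)) :
  family_free F H -> proper_box Y -> ~~ in_box Y (embedding H).
Proof.
by move=> freeH Yp; apply/negP => /(contains_of_box Yp)/(_ mA); exact: freeH.
Qed.

Lemma gen_turan_attained (G : sgraph) :
  gen_turan G T F = 0 \/
  exists2 H : pregraph G, family_free F H & gen_turan G T F = #|copies T H|.
Proof.
rewrite /gen_turan.
elim/big_ind: _ => [|x y hx hy|H /andP[_ /asboolP freeH]]; first by left.
  by case: (leqP x y).
by right; exists H.
Qed.

Lemma gen_turan_le_ffact (G : sgraph) : gen_turan G T F <= #|G| ^_ #|T|.
Proof.
have [->//|[H _ ->]] := gen_turan_attained G.
exact: leq_trans (leq_copies_embedding T H) (embedding_leq_ffact T H).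
Qed.

Lemma gen_turan_power_bound (G : sgraph) : 0 < #|G| ->
  gen_turan G T F ^ (m ^ #|T|) * #|G| <=
  #|T| * m ^ 2 * #|G| ^ (#|T| * m ^ #|T|).
Proof.
move=> G_gt0; have M_gt0 : 0 < m ^ #|T| by rewrite expn_gt0 m_gt0.
have [->|[H freeH ->]] := gen_turan_attained G; first by rewrite exp0n.
have := box_free_bound m_gt0 G_gt0 (fun Y => @free_box _ H Y freeH).
apply: leq_trans.
by rewrite leq_mul2r leq_exp2r // leq_copies_embedding orbT.
Qed.

(** When T has no vertex, the empty box always is a proper box, so F-free graphs
    do not exist and the maximum is over an empty range. *)
Lemma gen_turan_eq0 (G : sgraph) : #|T| = 0 -> gen_turan G T F = 0.
Proof.
move=> T0; have [//|[H freeH ->]] := gen_turan_attained G.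
apply/eqP; rewrite -leqn0 (leq_trans (leq_copies_embedding T H)) // leqn0.
rewrite sum_nat_eq0; apply/forallP => t; rewrite implyTb eqb0.
have Y_nil (W : finType) (Y : #|T|.-tuple W) : tval Y = [::].
  by apply/nilP; rewrite /nilp size_tuple T0.
have Y : #|T|.-tuple (m.-tuple G) by rewrite T0; exact: [tuple].
have /(free_box freeH) : proper_box Y by rewrite /proper_box Y_nil.
apply: contra => tE; apply/forallP => s; apply/implyP => _.
by rewrite (_ : s = t) //; apply: val_inj; rewrite /= !Y_nil.
Qed.
End GenTuran.

(** * A machine that tests whether the graph has a vertex *)

Definition nonempty_indicator (b : bool) (G : sgraph) : rat :=
  ((b && (0 < #|G|)%N)%:R)%R.

Section Machine.
Variable b : bool.

(** The machine reads the first cell only, then writes its answer from right to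
    left, starting with the blank that ends the word.  Thus it never meets the
    rest of the input, and its running time is constant.  The boolean component
    of the state remembers the leading bit, which is written last. *)
Definition writer_trans (q : 'I_5 * bool) (c : option (iosymbol + void)) :
    ('I_5 * bool) * option (iosymbol + void) * move :=
  let bit x := Some (inl (Bit x)) in
  match val q.1 with
  | 0 => ((inord 1, b && isSome c), None, MoveLeft)
  | 1 => ((inord 2, q.2), bit true, MoveLeft)
  | 2 => ((inord 3, q.2), Some (inl Slash), MoveLeft)
  | _ => ((inord 4, q.2), bit q.2, Stay)
  end.

Definition writer : machine :=
  @Machine ('I_5 * bool)%type void (ord0, false)
    (fun q => val q.1 == 4) writer_trans.

Lemma writer_computes (w : seq iosymbol) :
  computes_in writer w 4 [:: Bit (b && (0 < size w)); Slash; Bit true].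
Proof.
rewrite /computes_in /= /step /= /writer_trans /= !inordK //=.
split=> //; case: w => [|x w]; case=> [|[|[|[|k]]]] //=.
Qed.
End Machine.

Lemma size_encode_graph (G : sgraph) : size (encode_graph G) = #|G| * #|G|.
Proof. by rewrite size_allpairs -cardE. Qed.

Lemma encode_rat_bool (b : bool) :
  encode_rat b%:R%R = [:: Bit b; Slash; Bit true].
Proof.
by case: b; rewrite /encode_rat /encode_nat /= ?trunc_log0 ?trunc_log1 /=.
Qed.

Lemma polynomial_time_nonempty_indicator (b : bool) :
  polynomial_time (nonempty_indicator b).
Proof.
exists (writer b), 4%:P%R => G; exists 4; first by rewrite hornerC.
have := writer_computes b (encode_graph G).
by rewrite size_encode_graph muln_gt0 andbb -encode_rat_bool.
Qed.

(** * From the two integer bounds to a real exponent *)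

Local Open Scope ring_scope.

(** The bound y^M n <= c n^(kM) says that y <= c^(1/M) n^(k - 1/M).  For n > c^2
    the constant costs at most half of the gain 1/M in the exponent.  For
    smaller n, eps is so small that n^(k - eps) >= n^k - 1, and y is an integer
    below n^k. *)
Lemma exponent_gap (R : realType) (c k M : nat) : (0 < M)%N ->
  exists eps : R, [/\ 0 < eps, eps <= 1 &
    forall n y : nat, (0 < n)%N -> (y < n ^ k)%N ->
      (y ^ M * n <= c * n ^ (k * M))%N -> y%:R <= n%:R `^ (k%:R - eps) :> R].
Proof.
move=> M_gt0; set N := (c ^ 2).+1.
have D_gt0 : (0 < N ^ k.+1 * (2 * M))%N by rewrite muln_gt0 expn_gt0 muln_gt0.
(* The factor 2 M halves the gain 1/M; the factor N^(k+1) ensures that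
   n^k (1 - eps n) >= n^k - 1 for n < N. *)
pose eps : R := (N ^ k.+1 * (2 * M))%:R^-1.
have eps_gt0 : 0 < eps by rewrite invr_gt0 ltr0n.
exists eps; split => // [|n y n_gt0 y_lt y_le].
  by rewrite invf_le1 ?ler1n ?ltr0n.
have n0 : n%:R != 0 :> R by rewrite pnatr_eq0 -lt0n.
have n1 : 1 <= n%:R :> R by rewrite ler1n.
have [n_lt|n_ge] := ltnP n N.
  (* n^(- eps) = exp (- eps ln n) >= 1 - eps ln n. *)
  have le1 : 1 - eps * n%:R <= n%:R `^ (- eps).
    rewrite /powR (negPf n0) (le_trans _ (expR_ge1Dx _)) // lerD2l mulNr lerN2.
    by rewrite ler_wpM2l ?(ltW eps_gt0) // ltW // ln_sublinear ?ltr0n.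
  rewrite powRD ?n0 ?implybT // powR_mulrn // -natrX.
  apply: (le_trans _ (ler_wpM2l (ler0n _ _) le1)).
  rewrite mulrBr mulr1 lerBrDr.
  apply: (@le_trans _ _ (y%:R + 1)); last by rewrite natr1 ler_nat.
  rewrite lerD2l mulrCA mulrC -natrM -/eps ler_pdivrMr ?ltr0n // mul1r ler_nat.
  rewrite -expnSr (leq_trans (_ : _ <= N ^ k.+1)%N) ?leq_exp2r ?(ltnW n_lt) //.
  by rewrite leq_pmulr // muln_gt0.
have c_le : (y ^ (2 * M) * n <= n ^ (k * (2 * M)))%N.
  rewrite -(leq_pmul2r n_gt0).
  have -> : (n ^ (k * (2 * M)) = n ^ (k * M) * n ^ (k * M))%N.
    by rewrite -expnD; congr (_ ^ _)%N; lia.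
  have -> : (y ^ (2 * M) = y ^ M * y ^ M)%N.
    by rewrite -expnD; congr (_ ^ _)%N; lia.
  have := leq_mul y_le y_le.
  have := leq_mul (ltnW n_ge) (leqnn (n ^ (k * M) * n ^ (k * M))).
  by rewrite -mulnn; lia.
have M2_gt0 : (0 < 2 * M)%N by rewrite muln_gt0.
rewrite -(@ler_pXn2r _ (2 * M)) ?nnegrE ?powR_ge0 //.
rewrite -!powR_mulrn ?powR_ge0 // -powRrM.
apply: (@le_trans _ _ (n%:R `^ ((k * (2 * M))%:R - 1))).
  rewrite powRD ?n0 ?implybT // powR_inv1 //.
  by rewrite ler_pdivlMr ?ltr0n // !powR_mulrn // -!natrX -natrM ler_nat.
apply: ler_powR => //; rewrite mulrBl natrM lerD2l lerN2.
rewrite /eps natrM invfM -mulrA mulVf ?mulr1 ?pnatr_eq0 -?lt0n //.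
by rewrite invf_le1 ?ler1n ?ltr0n expn_gt0.
Qed.

(** * The estimate *)

Theorem proposition1p5 (R : realType) (T : sgraph) (F : sgraph -> Prop)
    (hF : exists A : sgraph, F A /\
            exists m : nat, (0 < m)%N /\ contains (full (blowup T m)) A) :
  exists eps : R, 0 < eps /\
    exists f : sgraph -> rat, polynomial_time f /\
      forall G : sgraph,
        `|ratr (f G) - (gen_turan G T F)%:R| <= #|G|%:R `^ (#|T|%:R - eps).
Proof.
case: hF => A [FA [m [m_gt0 mA]]].
have M_gt0 : (0 < m ^ #|T|)%N by rewrite expn_gt0 m_gt0.
have [eps [eps_gt0 eps_le1 gap]] :=
  exponent_gap R (#|T| * m ^ 2) #|T| M_gt0.
exists eps; split=> //; exists (nonempty_indicator (#|T| == 1)).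
split=> [|G]; first exact: polynomial_time_nonempty_indicator.
rewrite /nonempty_indicator ratr_nat; set x := gen_turan G T F.
have le_x : (x <= #|G| ^_ #|T|)%N by exact: gen_turan_le_ffact.
have x_T0 : #|T| = 0 -> x = 0 by exact: gen_turan_eq0 FA mA G.
have [G0|G_gt0] := posnP #|G|.
  suff -> : x = 0 by rewrite andbF subrr normr0 powR_ge0.
  have [/x_T0 //|T_gt0] := posnP #|T|.
  by apply/eqP; rewrite -leqn0 (leq_trans le_x) // G0 ffact_small.
have x_bound := gen_turan_power_bound FA m_gt0 mA G_gt0; rewrite -/x in x_bound.
rewrite andbT; have [T1|T_neq1] := eqVneq #|T| 1%N.
  (* The gap applies to x.-1 = |1 - x|, and |1 - 0| = 1 <= n^(1 - eps). *)
  have [->|x_gt0] := posnP x.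
    rewrite subr0 normr1 -[X in X <= _](powRr0 #|G|%:R) ler_powR ?ler1n //.
    by rewrite T1 subr_ge0.
  rewrite distrC ger0_norm ?subr_ge0 ?ler1n //.
  rewrite -(@natrB R x 1) // subn1 gap //.
    by rewrite -ltnS prednK // ltnS (leq_trans le_x) // ffact_le_expn.
  by rewrite (leq_trans _ x_bound) // leq_mul2r leq_exp2r // leq_pred orbT.
rewrite sub0r normrN normr_nat gap //.
case T_eq : #|T| T_neq1 le_x => [|[|k]] // _ le_x; first by rewrite x_T0.
by rewrite (leq_ltn_trans le_x) // ltn_ffact_expn.
Qed.
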